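(* Suppose that $0<\alpha<1$, $f\in X_\alpha$ and that the sample errors satisfy $|e_\ell|\le\varepsilon$ for all $\ell=1,\ldots,N$. Let $1\le j\le n_d$ and assume that both normalizing sums in the one-sided weights $w_{j\ell}^\pm$ are nonzero. Then the one-sided estimators $\widehat f_j^\pm$ and $\widehat\delta_j$ defined in the context satisfy $$|\widehat f_j^--f(t_j^d-0)|\le C_\gamma[f]_{\alpha,\Gamma_j^-}(r_j^-)^\alpha+\varepsilon,$$ $$|\widehat f_j^+-f(t_j^d+0)|\le C_\gamma[f]_{\alpha,\Gamma_j^+}(r_j^+)^\alpha+\varepsilon,$$ $$|\widehat\delta_j-[f]_{t_j^d}|\le C_\gamma\Big([f]_{\alpha,\Gamma_j^-}(r_j^-)^\alpha+[f]_{\alpha,\Gamma_j^+}(r_j^+)^\alpha\Big)+2\varepsilon,$$ where $\Gamma_j^-$ and $\Gamma_j^+$ are the incoming and outgoing continuity arcs adjacent to $t_j^d$, and $C_\gamma$ depends only on the equivalence between the parameter and contour metrics.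
   Context: **Contour.** $\Gamma\subset\mathbb C$ is a simple, closed, positively oriented contour of class $C^2$ with a regular $C^2$, $2\pi$-periodic parametrization $\gamma:\mathbb R\to\Gamma$ (so $\gamma(\theta+2\pi)=\gamma(\theta)$, $\gamma'(\theta)\ne0$, $\gamma$ injective on $[0,2\pi)$). $\mathcal D=\{t_1^d,\ldots,t_{n_d}^d\}\subset\Gamma$, $n_d\ge1$, is a set of distinct points, $t_j^d=\gamma(\theta_j^d)$ with $0<\theta_1^d<\cdots<\theta_{n_d}^d<2\pi$; the point $t_*=\gamma(0)=\gamma(2\pi)\notin\mathcal D$ is the cut. The continuity arcs are the $n_d$ open arcs of $\Gamma\setminus\mathcal D$. For a function $v$ with one-sided limits, $v(t_j^d\pm0)$ denote the limits along the orientation ($-$: incoming, $+$: outgoing), $[v]_{t_j^d}:=v(t_j^d+0)-v(t_j^d-0)$. **Spaces.** For $0<\sigma<1$, $X_\sigma=PH_\sigma(\Gamma,\mathcal D)$ is the space of complex functions that are $\sigma$-Hölder on every continuity arc and have finite lateral limits at all points of $\mathcal D$, with norm $\|v\|_{X_\sigma}=\max_I(\|v\|_{\infty,I}+[v]_{\sigma,I})$, the maximum over the continuity arcs $I$; here $\overline I^{\,\ell}$ is $I$ completed by its two endpoints carrying the lateral values, $\|v\|_{\infty,I}=\sup_{\overline I^{\,\ell}}|v|$ and $[v]_{\sigma,I}=\sup_{t\ne s\in\overline I^{\,\ell}}|v(t)-v(s)|/|t-s|^\sigma$. If $n_d=1$, the distance $|t-s|$ in this seminorm is understood as the distance along the (single)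 completed arc. **Samples and estimators.** The jump parameters $\theta_j^d$ are known, and the data are $y_\ell=f(\gamma(\vartheta_\ell))+e_\ell$, $\ell=1,\ldots,N$, with sample parameters $\vartheta_\ell$ ordered cyclically and none equal to a $\theta_j^d$. Bandwidths $r_j^-,r_j^+>0$ are small enough that the windows $(\theta_j^d-r_j^-,\theta_j^d)$ and $(\theta_j^d,\theta_j^d+r_j^+)$ remain inside the two continuity arcs adjacent to $t_j^d$ (in the parameter). Parameter differences are understood cyclically. $W:[0,1]\to[0,\infty)$ is a bounded weight function, positive on a neighborhood of the origin. Put $\mathcal I_j^-=\{\ell:0<\theta_j^d-\vartheta_\ell\le r_j^-\}$, $\mathcal I_j^+=\{\ell:0<\vartheta_\ell-\theta_j^d\le r_j^+\}$, $$w_{j\ell}^-=\frac{W((\theta_j^d-\vartheta_\ell)/r_j^-)}{\sum_{q\in\mathcal I_j^-}W((\theta_j^d-\vartheta_q)/r_j^-)},\qquad w_{j\ell}^+=\frac{W((\vartheta_\ell-\theta_j^d)/r_j^+)}{\sum_{q\in\mathcal I_j^+}W((\vartheta_q-\theta_j^d)/r_j^+)},$$ $$\widehat f_j^-=\sum_{\ell\in\mathcal I_j^-}w_{j\ell}^-y_\ell,\qquad \widehat f_j^+=\sum_{\ell\in\mathcal I_j^+}w_{j\ell}^+y_\ell,\qquad \widehat\delta_j=\widehat f_j^+-\widehat f_j^-.$$ *)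

(* Defs.v *)
From Stdlib Require Import Reals Arith.
From Coquelicot Require Import Coquelicot.
Open Scope R_scope.

Definition curve_deriv (gam : R -> C) (th : R) : C :=
  (Derive (fun u => Re (gam u)) th, Derive (fun u => Im (gam u)) th).

Definition C2_real (g : R -> R) : Prop :=
  (forall k x, (k <= 2)%nat -> ex_derive_n g k x)
  /\ (forall x, continuous (Derive_n g 2) x).

Definition on_curve (gam : R -> C) (z : C) : Prop := exists th, z = gam th.

Definition joined_off (gam : R -> C) (z w : C) : Prop :=
  exists p : R -> C,
    (forall s, continuous p s) /\ p 0 = z /\ p 1 = w
    /\ (forall s, 0 <= s <= 1 -> ~ on_curve gam (p s)).

(** The complement of the curve is open, so its connected components are its
    path components; the interior is the union of the bounded ones. *)
Definition inside (gam : R -> C) (z : C) : Prop :=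
  ~ on_curve gam z /\ exists M, forall w, joined_off gam z w -> Cmod w <= M.

Definition winding (gam : R -> C) (z : C) : C :=
  let h := fun th => (curve_deriv gam th / (gam th - z))%C in
  ((RInt (fun th => Re (h th)) 0 (2 * PI), RInt (fun th => Im (h th)) 0 (2 * PI))
     / (2 * PI * Ci))%C.

Record contour (gam : R -> C) : Prop := {
  contour_re_C2 : C2_real (fun th => Re (gam th));
  contour_im_C2 : C2_real (fun th => Im (gam th));
  contour_periodic : forall th, gam (th + 2 * PI) = gam th;
  contour_regular : forall th, curve_deriv gam th <> 0%C;
  contour_simple : forall th th',
    0 <= th < 2 * PI -> 0 <= th' < 2 * PI -> gam th = gam th' -> th = th';
  contour_positive : forall z, inside gam z -> winding gam z = 1%C
}.

(** Equivalence of the cyclic parameter distance and the distance in [C]: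
    modulo [2 * PI] every pair of parameters has representatives with
    [Rabs (th - th') <= PI], and [Rabs (th - th')] is then the cyclic distance. *)
Definition metric_equiv (gam : R -> C) (c1 c2 : R) : Prop :=
  0 < c1 /\ 0 < c2 /\
  forall th th', Rabs (th - th') <= PI ->
    c1 * Rabs (th - th') <= Cmod (gam th - gam th') <= c2 * Rabs (th - th').

(** Jump parameters are [thd 1 < ... < thd nd].  A continuity arc is given by
    the open parameter interval [(a, b)] it is the image of; the arc through the
    cut is represented by an interval of real parameters that crosses a multiple
    of [2 * PI]. *)

Definition jump_params (nd : nat) (thd : nat -> R) : Prop :=
  (forall j, (1 <= j <= nd)%nat -> 0 < thd j < 2 * PI)
  /\ (forall j, (1 <= j < nd)%nat -> thd j < thd (S j)).

Definition thd_next (nd : nat) (thd : nat -> R) (j : nat) : R :=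
  if Nat.eqb j nd then thd 1%nat + 2 * PI else thd (S j).

Definition thd_prev (nd : nat) (thd : nat -> R) (j : nat) : R :=
  if Nat.eqb j 1 then thd nd - 2 * PI else thd (Nat.pred j).

(** [v (gam th - 0)] and [v (gam th + 0)]; junk value if the limit does not exist. *)
Definition lat_minus (gam : R -> C) (v : C -> C) (th : R) : C :=
  lim (T := C_CompleteNormedModule) (filtermap (fun u => v (gam u)) (at_left th)).

Definition lat_plus (gam : R -> C) (v : C -> C) (th : R) : C :=
  lim (T := C_CompleteNormedModule) (filtermap (fun u => v (gam u)) (at_right th)).

Definition jump (gam : R -> C) (v : C -> C) (th : R) : C :=
  (lat_plus gam v th - lat_minus gam v th)%C.

Definition arc_length (gam : R -> C) (th th' : R) : R :=
  Rabs (RInt (fun u => Cmod (curve_deriv gam u)) th th').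

(** Distance between points of one completed arc: the distance in [C], except
    that the single completed arc of [nd = 1] carries its arc length, since its
    two endpoints coincide in [C]. *)
Definition arc_dist (nd : nat) (gam : R -> C) (th th' : R) : R :=
  if Nat.eqb nd 1 then arc_length gam th th' else Cmod (gam th - gam th').

Definition completed (gam : R -> C) (v : C -> C) (a b th : R) : C :=
  if Req_EM_T th a then lat_plus gam v a
  else if Req_EM_T th b then lat_minus gam v b
  else v (gam th).

(** The seminorm [[v]_{sigma, I}] of the arc [I] with parameters [(a, b)].
    [th <> th'] both states that the two points of the completed arc differ and
    keeps [Rpower] away from [0], where it is not the power function. *)
Definition holder_seminorm (nd : nat) (gam : R -> C) (sigma : R) (v : C -> C)
    (a b : R) : R :=
  real (Lub_Rbar (fun x => exists th th',
    a <= th <= b /\ a <= th' <= b /\ th <> th' /\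
    x = Cmod (completed gam v a b th - completed gam v a b th')
        / Rpower (arc_dist nd gam th th') sigma)).

Definition holder_on_arc (nd : nat) (gam : R -> C) (sigma : R) (v : C -> C)
    (a b : R) : Prop :=
  exists K, forall th th', a < th < b -> a < th' < b -> th <> th' ->
    Cmod (v (gam th) - v (gam th')) <= K * Rpower (arc_dist nd gam th th') sigma.

(** [v] is in [PH_sigma(Gamma, D)]; the values of [v] off [Gamma] and at the
    jump points play no role. *)
Definition PH (nd : nat) (gam : R -> C) (thd : nat -> R) (sigma : R) (v : C -> C)
    : Prop :=
  forall j, (1 <= j <= nd)%nat ->
    holder_on_arc nd gam sigma v (thd j) (thd_next nd thd j)
    /\ (exists l : C, filterlim (fun u => v (gam u)) (at_left (thd j)) (locally l))
    /\ (exists l : C, filterlim (fun u => v (gam u)) (at_right (thd j)) (locally l)).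

(** Cyclic difference: the representative of [x - y] modulo [2 * PI] in
    [[0, 2 * PI)]. *)
Definition cdiff (x y : R) : R :=
  (x - y) - 2 * PI * IZR (Int_part ((x - y) / (2 * PI))).

Definition cyclically_ordered (N : nat) (vth : nat -> R) : Prop :=
  exists k : nat -> Z,
    let lift := fun l => vth l + 2 * PI * IZR (k l) in
    (forall l, (1 <= l < N)%nat -> lift l <= lift (S l))
    /\ lift N <= lift 1%nat + 2 * PI.

Record weight_function (W : R -> R) : Prop := {
  weight_nonneg : forall u, 0 <= u <= 1 -> 0 <= W u;
  weight_bounded : exists M, forall u, 0 <= u <= 1 -> W u <= M;
  weight_pos_near_0 : exists eta, 0 < eta /\ forall u, 0 <= u <= 1 -> u < eta -> 0 < W u
}.

(** [W (d / r)] for [d] in the window [0 < d <= r], and [0] otherwise, so that a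
    sum over all samples is the sum over the window. *)
Definition kernel (W : R -> R) (r d : R) : R :=
  if Rlt_dec 0 d then if Rle_dec d r then W (d / r) else 0 else 0.

Definition dist_minus (thd vth : nat -> R) (j l : nat) : R := cdiff (thd j) (vth l).
Definition dist_plus (thd vth : nat -> R) (j l : nat) : R := cdiff (vth l) (thd j).

(** In what follows [d l] is the one-sided distance of sample [l] to the jump. *)
Definition norm_sum (W : R -> R) (N : nat) (r : R) (d : nat -> R) : R :=
  sum_n_m (fun q => kernel W r (d q)) 1 N.

Definition weight (W : R -> R) (N : nat) (r : R) (d : nat -> R) (l : nat) : R :=
  kernel W r (d l) / norm_sum W N r d.

Definition estimator (W : R -> R) (N : nat) (r : R) (d : nat -> R) (y : nat -> C) : C :=
  sum_n_m (G := C_AbelianGroup) (fun l => (RtoC (weight W N r d l) * y l)%C) 1 N.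

(* Main.v *)
Require Import Defs.
From Stdlib Require Import Reals Arith ZArith Lra Lia ClassicalEpsilon.
From Coquelicot Require Import Coquelicot.
Open Scope R_scope.

(** The equivalence of the metrics holds because the chord-to-parameter ratio is
    locally bounded below, near the diagonal by regularity and away from it by
    injectivity, hence uniformly by compactness.  An estimator is a convex
    combination of samples in the window, so its error is at most the worst sample
    error, which the Hölder bound on the completed arc controls: arc distances are
    at most [c2] times parameter distances, and [Rpower c2 alpha <= Rmax 1 c2].  The
    Hölder constant of the open arc passes to the completed arc by taking limits at
    its endpoints. *)

(** * Periodicity and injectivity of the parametrization modulo full turns *)

Lemma two_PI_representative (x : R) :
  exists k : Z, 0 <= x + 2 * PI * IZR k < 2 * PI.
Proof.
  pose proof PI_RGT_0.
  exists (- Int_part (x / (2 * PI)))%Z.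
  destruct (base_Int_part (x / (2 * PI))) as [h1 h2].
  rewrite opp_IZR.
  assert (e : x = 2 * PI * (x / (2 * PI))) by (field; lra).
  rewrite e at 1 3; nra.
Qed.

Section Contour.

Variable gam : R -> C.
Hypothesis Hgam : contour gam.

Lemma contour_periodic_Z (k : Z) (th : R) : gam (th + 2 * PI * IZR k) = gam th.
Proof.
  assert (nat_case : forall n x, gam (x + 2 * PI * INR n) = gam x).
  { induction n as [|n IH]; intros x.
    - simpl; now rewrite Rmult_0_r, Rplus_0_r.
    - rewrite S_INR.
      replace (x + 2 * PI * (INR n + 1)) with ((x + 2 * PI * INR n) + 2 * PI) by ring.
      now rewrite (contour_periodic _ Hgam). }
  destruct (Z.le_gt_cases 0 k).
  - rewrite <- (Z2Nat.id k) by lia. rewrite <- INR_IZR_INZ. apply nat_case.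
  - rewrite <- (nat_case (Z.to_nat (- k)) (th + 2 * PI * IZR k)).
    rewrite INR_IZR_INZ, Z2Nat.id, opp_IZR by lia. f_equal; ring.
Qed.

Lemma contour_injective_mod (u v : R) :
  gam u = gam v -> exists k : Z, u - v = 2 * PI * IZR k.
Proof.
  intros E.
  destruct (two_PI_representative u) as [k hk], (two_PI_representative v) as [m hm].
  assert (e : u + 2 * PI * IZR k = v + 2 * PI * IZR m).
  { apply (contour_simple _ Hgam); auto. now rewrite !contour_periodic_Z. }
  exists (m - k)%Z. rewrite minus_IZR. lra.
Qed.

Lemma small_two_PI_multiple (k : Z) : Rabs (2 * PI * IZR k) < 2 * PI -> k = 0%Z.
Proof.
  pose proof PI_RGT_0. intros h.
  destruct (Z.eq_dec k 0) as [|nz]; auto. exfalso.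
  rewrite Rabs_mult, (Rabs_right (2 * PI)), Rabs_Zabs in h by lra.
  assert (1 <= IZR (Z.abs k)) by (apply IZR_le; lia). nra.
Qed.

Lemma contour_injective_near (u v : R) : Rabs (u - v) < 2 * PI -> gam u = gam v -> u = v.
Proof.
  intros h E. destruct (contour_injective_mod u v E) as [k e].
  rewrite e in h. apply small_two_PI_multiple in h. subst k. simpl in e. lra.
Qed.

End Contour.

(** * Lipschitz and expansion bounds for real functions of class $C^2$ *)

Lemma C2_real_is_derive (g : R -> R) (x : R) : C2_real g -> is_derive g x (Derive g x).
Proof. intros [h _]. apply Derive_correct, (h 1%nat x); lia. Qed.

Lemma C2_real_continuity_pt (g : R -> R) (x : R) : C2_real g -> continuity_pt g x.
Proof.
  intros h. apply continuity_pt_filterlim, (ex_derive_continuous (V := R_NormedModule) g).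
  eexists; now apply C2_real_is_derive.
Qed.

Lemma C2_real_continuous_Derive (g : R -> R) (x : R) : C2_real g -> continuous (Derive g) x.
Proof.
  intros [h _]. apply (ex_derive_continuous (V := R_NormedModule)), (h 2%nat x); lia.
Qed.

Lemma C2_real_MVT (g : R -> R) (x y : R) : C2_real g ->
  exists c, Rmin x y <= c <= Rmax x y /\ g x - g y = Derive g c * (x - y).
Proof.
  intros h.
  destruct (MVT_gen g y x (Derive g)) as (c & hc & e).
  - intros; now apply C2_real_is_derive.
  - intros; now apply C2_real_continuity_pt.
  - exists c. now rewrite Rmin_comm, Rmax_comm.
Qed.

Lemma C2_real_lipschitz (g : R -> R) (a b : R) : a <= b -> C2_real g ->
  exists K, 0 <= K /\ forall x y, a <= x <= b -> a <= y <= b ->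
    Rabs (g x - g y) <= K * Rabs (x - y).
Proof.
  intros ab h.
  destruct (continuity_ab_maj (fun x => Rabs (Derive g x)) a b ab) as (m & hm & _).
  { intros c _. apply continuity_pt_filterlim, continuous_comp.
    - now apply C2_real_continuous_Derive.
    - apply continuous_Rabs. }
  exists (Rabs (Derive g m)); split; [apply Rabs_pos|]. intros x y hx hy.
  destruct (C2_real_MVT g x y h) as (c & hc & ->).
  rewrite Rabs_mult. apply Rmult_le_compat_r; [apply Rabs_pos|].
  apply hm. unfold Rmin, Rmax in hc. destruct (Rle_dec x y); lra.
Qed.

(** By continuity the derivative keeps at least half of its absolute value at [u] on a neighborhood,
    and the mean value theorem turns this into expansion. One number [d] is both the radius and the
    rate, so that a single positive function can serve as the gauge in a compactness argument. *)
Lemma C2_real_expands_near (g : R -> R) (u : R) : C2_real g -> Derive g u <> 0 ->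
  exists d, 0 < d /\ forall x y, Rabs (x - u) < d -> Rabs (y - u) < d ->
    d * Rabs (x - y) <= Rabs (g x - g y).
Proof.
  intros h nz.
  assert (hpos : 0 < Rabs (Derive g u) / 2) by (apply Rabs_pos_lt in nz; lra).
  pose proof (C2_real_continuous_Derive g u h) as hc.
  apply filterlim_locally with (eps := mkposreal _ hpos) in hc.
  destruct hc as [d hd].
  exists (Rmin d (Rabs (Derive g u) / 2)); split.
  { apply Rmin_pos; auto. apply cond_pos. }
  intros x y hx hy.
  destruct (C2_real_MVT g x y h) as (c & hcb & ->).
  rewrite Rabs_mult. apply Rmult_le_compat_r; [apply Rabs_pos|].
  eapply Rle_trans; [apply Rmin_r|].
  assert (hcu : Rabs (c - u) < d).
  { pose proof (Rmin_l d (Rabs (Derive g u) / 2)).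
    apply Rabs_def2 in hx. apply Rabs_def2 in hy.
    apply Rabs_def1; unfold Rmin, Rmax in hcb; destruct (Rle_dec x y); lra. }
  specialize (hd c hcu). change (Rabs (Derive g c - Derive g u) < Rabs (Derive g u) / 2) in hd.
  rewrite Rabs_minus_sym in hd.
  pose proof (Rabs_triang_inv (Derive g u) (Derive g c)). lra.
Qed.

(** * Equivalence of the parameter distance and the chord distance *)

Section MetricEquivalence.

Variable gam : R -> C.
Hypothesis Hgam : contour gam.

Let g1 (th : R) := Re (gam th).
Let g2 (th : R) := Im (gam th).

Lemma Cmod_le_Rabs_Re_Im (z : C) : Cmod z <= Rabs (Re z) + Rabs (Im z).
Proof.
  destruct z as [x y]; simpl.
  replace (x, y) with (RtoC x + Ci * RtoC y)%C
    by (unfold Cplus, Cmult, Ci, RtoC; simpl; f_equal; ring).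
  eapply Rle_trans; [apply Cmod_triangle|].
  rewrite Cmod_mult, !Cmod_R.
  replace (Cmod Ci) with 1; [lra|].
  unfold Cmod, Ci; simpl. replace (0 * (0 * 1) + 1 * (1 * 1)) with 1 by ring.
  now rewrite sqrt_1.
Qed.

Lemma contour_lipschitz (a b : R) : a <= b ->
  exists K, 0 <= K /\ forall x y, a <= x <= b -> a <= y <= b ->
    Cmod (gam x - gam y) <= K * Rabs (x - y).
Proof.
  intros ab.
  destruct (C2_real_lipschitz g1 a b ab (contour_re_C2 _ Hgam)) as (K1 & p1 & h1).
  destruct (C2_real_lipschitz g2 a b ab (contour_im_C2 _ Hgam)) as (K2 & p2 & h2).
  exists (K1 + K2); split; [lra|]. intros x y hx hy.
  eapply Rle_trans; [apply Cmod_le_Rabs_Re_Im|].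
  specialize (h1 x y hx hy). specialize (h2 x y hx hy).
  rewrite Rmult_plus_distr_r. apply Rplus_le_compat; [exact h1|exact h2].
Qed.

(** Regularity makes the derivative of one coordinate nonzero at [u]; that coordinate expands
    nearby, and its increment is at most the chord. *)
Lemma contour_expands_near (u : R) :
  exists d, 0 < d /\ forall x y, Rabs (x - u) < d -> Rabs (y - u) < d ->
    d * Rabs (x - y) <= Cmod (gam x - gam y).
Proof.
  destruct (Req_dec (Derive g1 u) 0) as [z1|nz1].
  - destruct (Req_dec (Derive g2 u) 0) as [z2|nz2].
    + exfalso. apply (contour_regular _ Hgam u).
      unfold curve_deriv. unfold g1, g2 in z1, z2. now rewrite z1, z2.
    + destruct (C2_real_expands_near g2 u (contour_im_C2 _ Hgam) nz2) as (d & hd & h).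
      exists d; split; auto. intros x y hx hy.
      eapply Rle_trans; [apply h; auto|]. eapply Rle_trans; [|apply (Rmax_Cmod (gam x - gam y)%C)]. apply Rmax_r.
  - destruct (C2_real_expands_near g1 u (contour_re_C2 _ Hgam) nz1) as (d & hd & h).
    exists d; split; auto. intros x y hx hy.
    eapply Rle_trans; [apply h; auto|]. apply (re_le_Cmod (gam x - gam y)%C).
Qed.

(** The case [u = v] is regularity; elsewhere the chord is bounded away from [0]
    unless the constraint [Rabs (x - y) <= PI] is violated near [(u, v)]. *)
Lemma contour_expands_near_pair (u v : R) :
  exists d : posreal, forall x y, Rabs (x - u) < d -> Rabs (y - v) < d ->
    Rabs (x - y) <= PI -> d * Rabs (x - y) <= Cmod (gam x - gam y).
Proof.
  pose proof PI_RGT_0 as hpi.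
  destruct (Req_dec u v) as [<-|nuv].
  { destruct (contour_expands_near u) as (d & hd & h).
    exists (mkposreal d hd). intros; now apply h. }
  destruct (Rle_lt_dec (Rabs (u - v)) PI) as [le|lt].
  - assert (npos : 0 < Cmod (gam u - gam v)).
    { apply Cmod_gt_0. intros E. apply nuv, (contour_injective_near gam Hgam).
      - lra.
      - replace (gam u) with ((gam u - gam v) + gam v)%C by ring. rewrite E; ring. }
    destruct (contour_lipschitz (Rmin u v - 1) (Rmax u v + 1)) as (K & hK & hL).
    { unfold Rmin, Rmax; destruct (Rle_dec u v); lra. }
    set (m := Cmod (gam u - gam v)) in *.
    (* The bound 1 keeps [x] and [y] in the interval on which [K] is a Lipschitz constant. The bound
       by [m / (4 * K + 4)] moves each end of the chord by at most [m / 4], which leaves a chord of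
       at least [m / 2]; the bound by [m / (2 * PI)] gives [d * PI <= m / 2]. *)
    set (d := Rmin 1 (Rmin (m / (2 * PI)) (m / (4 * K + 4)))).
    assert (hd : 0 < d).
    { repeat apply Rmin_pos; try lra; apply Rdiv_lt_0_compat; lra. }
    exists (mkposreal d hd). simpl. intros x y hx hy hxy.
    assert (d1 : d <= 1) by apply Rmin_l.
    assert (d2 : d <= m / (2 * PI)) by (eapply Rle_trans; [apply Rmin_r|apply Rmin_l]).
    assert (d3 : d <= m / (4 * K + 4)) by (eapply Rle_trans; [apply Rmin_r|apply Rmin_r]).
    assert (e2 : d * PI <= m / 2).
    { replace (m / 2) with (m / (2 * PI) * PI) by (field; lra).
      apply Rmult_le_compat_r; lra. }
    assert (e3 : K * d <= m / 4).
    { apply Rle_trans with ((K + 1) * (m / (4 * K + 4))).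
      - apply Rmult_le_compat; lra.
      - right; field; lra. }
    assert (bx : Cmod (gam u - gam x) <= m / 4).
    { eapply Rle_trans; [apply hL|].
      - unfold Rmin, Rmax; destruct (Rle_dec u v); lra.
      - apply Rabs_def2 in hx; unfold Rmin, Rmax; destruct (Rle_dec u v); lra.
      - rewrite Rabs_minus_sym. apply Rle_trans with (K * d); auto.
        apply Rmult_le_compat_l; lra. }
    assert (byv : Cmod (gam y - gam v) <= m / 4).
    { eapply Rle_trans; [apply hL|].
      - apply Rabs_def2 in hy; unfold Rmin, Rmax; destruct (Rle_dec u v); lra.
      - unfold Rmin, Rmax; destruct (Rle_dec u v); lra.
      - apply Rle_trans with (K * d); auto. apply Rmult_le_compat_l; lra. }
    assert (tri : m <= Cmod (gam u - gam x) + Cmod (gam x - gam y) + Cmod (gam y - gam v)).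
    { unfold m.
      replace (gam u - gam v)%C with ((gam u - gam x) + (gam x - gam y) + (gam y - gam v))%C
        by ring.
      eapply Rle_trans; [apply Cmod_triangle|]. apply Rplus_le_compat_r, Cmod_triangle. }
    apply Rle_trans with (d * PI).
    + apply Rmult_le_compat_l; lra.
    + lra.
  (* With half of the excess over [PI] as radius, nearby [x] and [y] still differ by more than [PI],
     so the claim is vacuous. *)
  - assert (hd : 0 < (Rabs (u - v) - PI) / 2) by lra.
    exists (mkposreal _ hd). simpl. intros x y hx hy hxy. exfalso.
    apply Rabs_def2 in hx. apply Rabs_def2 in hy.
    unfold Rabs in *. destruct (Rcase_abs (u - v)), (Rcase_abs (x - y)); lra.
Qed.

Lemma contour_metric_equiv : exists c1 c2 : R, metric_equiv gam c1 c2.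
Proof.
  pose proof PI_RGT_0 as hpi.
  (* Choice turns the local radii into a gauge function, as the compactness lemma for rectangles
     requires. *)
  pose (delta u v := proj1_sig (constructive_indefinite_description _
                                  (contour_expands_near_pair u v))).
  (* Once the first parameter is translated into $[0,2\pi)$, a second one within [PI] of it lies
     between [- PI] and [3 * PI]. *)
  destruct (compactness_value_2d 0 (2 * PI) (- PI) (3 * PI) delta) as [d hd].
  destruct (contour_lipschitz (- PI) (3 * PI)) as (K & hK & hL); [lra|].
  (* The upper constant has to be positive, whereas [K] is only nonnegative. *)
  exists d, (K + 1). split; [apply cond_pos|]. split; [lra|].
  intros th th' hth.
  destruct (two_PI_representative th) as [k hk].
  rewrite <- (contour_periodic_Z gam Hgam k th), <- (contour_periodic_Z gam Hgam k th').
  replace (th - th') with ((th + 2 * PI * IZR k) - (th' + 2 * PI * IZR k)) in * by ring.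
  set (x := th + 2 * PI * IZR k) in *. set (y := th' + 2 * PI * IZR k) in *.
  assert (hy : - PI <= y <= 3 * PI) by (apply Rabs_le_between in hth; lra).
  split.
  (* Compactness yields the gauge point [(u, v)] only under a double negation, hence the argument by
     contradiction. *)
  - apply Rnot_lt_le. intros lt. apply (hd x y); [lra|auto|].
    intros (u & v & _ & _ & hu & hv & hduv).
    apply (Rlt_not_le _ _ lt).
    eapply Rle_trans; [apply Rmult_le_compat_r; [apply Rabs_pos|exact hduv]|].
    unfold delta in *.
    destruct (constructive_indefinite_description _ (contour_expands_near_pair u v))
      as [e he]; simpl in *.
    now apply he.
  - eapply Rle_trans; [apply hL; lra|]. apply Rmult_le_compat_r; [apply Rabs_pos|lra].
Qed.

End MetricEquivalence.

(** * The distance on a completed arc and its bound by the parameter distance *)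

Lemma Cmod_minus_sym (z w : C) : Cmod (z - w) = Cmod (w - z).
Proof. rewrite <- Cmod_opp. f_equal; ring. Qed.

Lemma Cmod_minus_triangle (z w u : C) : Cmod (z - u) <= Cmod (z - w) + Cmod (w - u).
Proof.
  replace (z - u)%C with ((z - w) + (w - u))%C by ring. apply Cmod_triangle.
Qed.

Section ArcDistance.

Variable gam : R -> C.
Hypothesis Hgam : contour gam.

Lemma contour_continuous_speed (th : R) : continuous (fun u => Cmod (curve_deriv gam u)) th.
Proof.
  assert (sq : forall g, C2_real g -> continuous (fun u => Derive g u ^ 2) th).
  { intros g hg. apply (continuous_ext (fun u => Derive g u * Derive g u)).
    - intros; simpl; ring.
    - apply (continuous_mult (K := R_AbsRing)); now apply C2_real_continuous_Derive. }
  apply continuous_sqrt_comp.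
  apply (continuous_plus (V := R_NormedModule)
    (fun u => Derive (fun th => Re (gam th)) u ^ 2)
    (fun u => Derive (fun th => Im (gam th)) u ^ 2)); apply sq, Hgam.
Qed.

Lemma contour_ex_RInt_speed (a b : R) : ex_RInt (fun u => Cmod (curve_deriv gam u)) a b.
Proof.
  apply (ex_RInt_continuous (V := R_CompleteNormedModule)).
  intros; apply contour_continuous_speed.
Qed.

Lemma arc_length_sym (x y : R) : arc_length gam x y = arc_length gam y x.
Proof.
  unfold arc_length. rewrite <- (opp_RInt_swap (V := R_CompleteNormedModule)).
  - apply Rabs_Ropp.
  - apply contour_ex_RInt_speed.
Qed.

Lemma arc_length_triangle (x y z : R) :
  arc_length gam x z <= arc_length gam x y + arc_length gam y z.
Proof.
  unfold arc_length.
  rewrite <- (RInt_Chasles (V := R_CompleteNormedModule) _ x y z)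
    by apply contour_ex_RInt_speed.
  apply Rabs_triang.
Qed.

Lemma arc_length_pos (x y : R) : x <> y -> 0 < arc_length gam x y.
Proof.
  assert (ordered : forall x y, x < y -> 0 < arc_length gam x y).
  { intros u v lt. apply Rabs_pos_lt, Rgt_not_eq, RInt_gt_0; auto.
    - intros w _. apply Cmod_gt_0, (contour_regular _ Hgam).
    - intros w _. apply contour_continuous_speed. }
  intros ne. destruct (Rtotal_order x y) as [lt|[e|gt]]; [auto|contradiction|].
  rewrite arc_length_sym; auto.
Qed.

Lemma curve_deriv_periodic (th : R) : curve_deriv gam (th + 2 * PI) = curve_deriv gam th.
Proof.
  unfold curve_deriv, Derive. f_equal; f_equal; apply Lim_ext; intros h.
  all: replace (th + 2 * PI + h) with (th + h + 2 * PI) by ring;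
    now rewrite !(contour_periodic _ Hgam).
Qed.

Lemma arc_length_periodic (x y : R) :
  arc_length gam (x + 2 * PI) (y + 2 * PI) = arc_length gam x y.
Proof.
  unfold arc_length. f_equal.
  pose proof (RInt_comp_lin (V := R_CompleteNormedModule)
                (fun u => Cmod (curve_deriv gam u)) 1 (2 * PI) x y) as E.
  rewrite !Rmult_1_l in E. rewrite <- E by apply contour_ex_RInt_speed.
  apply RInt_ext. intros u _.
  change (scal 1 ?z) with (1 * z). now rewrite !Rmult_1_l, curve_deriv_periodic.
Qed.

Lemma arc_dist_periodic (nd : nat) (x y : R) :
  arc_dist nd gam (x + 2 * PI) (y + 2 * PI) = arc_dist nd gam x y.
Proof.
  unfold arc_dist. now rewrite arc_length_periodic, !(contour_periodic _ Hgam).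
Qed.

Lemma arc_dist_sym (nd : nat) (x y : R) : arc_dist nd gam x y = arc_dist nd gam y x.
Proof.
  unfold arc_dist. destruct (Nat.eqb nd 1); [apply arc_length_sym|apply Cmod_minus_sym].
Qed.

Lemma arc_dist_triangle (nd : nat) (x y z : R) :
  arc_dist nd gam x z <= arc_dist nd gam x y + arc_dist nd gam y z.
Proof.
  unfold arc_dist.
  destruct (Nat.eqb nd 1); [apply arc_length_triangle|apply Cmod_minus_triangle].
Qed.

(** Arc length separates any two parameters, including the two ends of the single arc when [nd = 1].
    The chord separates them only within less than a full turn, hence the alternative in the
    hypothesis. *)
Lemma arc_dist_pos (nd : nat) (x y : R) :
  x <> y -> nd = 1%nat \/ Rabs (x - y) < 2 * PI -> 0 < arc_dist nd gam x y.
Proof.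
  intros ne h. unfold arc_dist. destruct (Nat.eqb_spec nd 1).
  - now apply arc_length_pos.
  - destruct h as [|h]; [contradiction|].
    apply Cmod_gt_0. intros E. apply ne, (contour_injective_near gam Hgam); auto.
    replace (gam x) with ((gam x - gam y) + gam y)%C by ring. rewrite E; ring.
Qed.

Variables c1 c2 : R.
Hypothesis Hc : metric_equiv gam c1 c2.

(** A continuity arc can exceed half a turn, where [metric_equiv] says nothing directly. Passing
    through the midpoint parameter gives two steps of at most [PI], without loss in the constant. *)
Lemma metric_equiv_upper (x y : R) :
  Rabs (x - y) <= 2 * PI -> Cmod (gam x - gam y) <= c2 * Rabs (x - y).
Proof.
  intros h. destruct Hc as (_ & _ & H).
  set (z := (x + y) / 2).
  assert (ex : Rabs (x - z) = Rabs (x - y) / 2).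
  { replace (x - z) with ((x - y) / 2) by (unfold z; field).
    unfold Rdiv. rewrite Rabs_mult, (Rabs_right (/ 2)); lra. }
  assert (ey : Rabs (z - y) = Rabs (x - y) / 2).
  { replace (z - y) with ((x - y) / 2) by (unfold z; field).
    unfold Rdiv. rewrite Rabs_mult, (Rabs_right (/ 2)); lra. }
  pose proof (H x z ltac:(lra)). pose proof (H z y ltac:(lra)).
  pose proof (Cmod_minus_triangle (gam x) (gam z) (gam y)). nra.
Qed.

(** The speed is the limit of moduli of difference quotients, each of which is at most [c2]. *)
Lemma metric_equiv_speed_le (u : R) : Cmod (curve_deriv gam u) <= c2.
Proof.
  pose proof PI_RGT_0 as hpi.
  apply Rnot_lt_le. intros lt.
  (* One third of the assumed excess: the real and imaginary parts of the quotient each err by less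
     than [eps], so its modulus would still exceed [c2]. *)
  set (eps := (Cmod (curve_deriv gam u) - c2) / 3).
  assert (he : 0 < eps) by (unfold eps; lra).
  pose proof (proj1 (is_derive_Reals _ _ _)
    (C2_real_is_derive _ u (contour_re_C2 _ Hgam)) eps he) as [d1 h1].
  pose proof (proj1 (is_derive_Reals _ _ _)
    (C2_real_is_derive _ u (contour_im_C2 _ Hgam)) eps he) as [d2 h2].
  set (h := Rmin PI (Rmin d1 d2) / 2).
  assert (hm : 0 < Rmin PI (Rmin d1 d2)) by (repeat apply Rmin_pos; auto; apply cond_pos).
  pose proof (Rmin_l PI (Rmin d1 d2)). pose proof (Rmin_r PI (Rmin d1 d2)).
  pose proof (Rmin_l d1 d2). pose proof (Rmin_r d1 d2).
  assert (hp : 0 < h) by (unfold h; lra).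
  assert (ha : Rabs h = h) by (apply Rabs_right; lra).
  specialize (h1 h ltac:(lra) ltac:(rewrite ha; unfold h in *; lra)).
  specialize (h2 h ltac:(lra) ltac:(rewrite ha; unfold h in *; lra)).
  set (q := ((gam (u + h) - gam u) / RtoC h)%C).
  assert (nz : RtoC h <> 0%C) by (intros E; apply RtoC_inj in E; lra).
  assert (bq : Cmod q <= c2).
  { unfold q. rewrite Cmod_div, Cmod_R, ha by auto.
    apply Rle_div_l; [lra|].
    eapply Rle_trans; [apply metric_equiv_upper|];
      replace (u + h - u) with h by ring; rewrite ha; unfold h in *; lra. }
  assert (bd : Cmod (q - curve_deriv gam u) < 2 * eps).
  { eapply Rle_lt_trans; [apply Cmod_le_Rabs_Re_Im|].
    replace (Re (q - curve_deriv gam u))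
      with ((Re (gam (u + h)) - Re (gam u)) / h - Derive (fun th => Re (gam th)) u)
      by (unfold q, curve_deriv, Re, Im; simpl; field; lra).
    replace (Im (q - curve_deriv gam u))
      with ((Im (gam (u + h)) - Im (gam u)) / h - Derive (fun th => Im (gam th)) u)
      by (unfold q, curve_deriv, Re, Im; simpl; field; lra).
    lra. }
  rewrite Cmod_minus_sym in bd.
  pose proof (Cmod_triangle (curve_deriv gam u - q) q) as tri.
  replace (curve_deriv gam u - q + q)%C with (curve_deriv gam u) in tri by ring.
  unfold eps in *; lra.
Qed.

Lemma arc_length_upper (x y : R) : arc_length gam x y <= c2 * Rabs (x - y).
Proof.
  assert (ordered : forall x y, x <= y -> arc_length gam x y <= c2 * Rabs (x - y)).
  { intros a b le. unfold arc_length. eapply Rle_trans; [apply abs_RInt_le; auto|].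
    - apply contour_ex_RInt_speed.
    - eapply Rle_trans.
      + apply RInt_le with (g := fun _ => c2); auto.
        * apply (ex_RInt_ext (V := R_NormedModule) (fun u => Cmod (curve_deriv gam u))).
          -- intros w _. symmetry. apply Rabs_right, Rle_ge, Cmod_ge_0.
          -- apply contour_ex_RInt_speed.
        * apply (ex_RInt_const (V := R_NormedModule)).
        * intros w _. rewrite Rabs_right by (apply Rle_ge, Cmod_ge_0).
          apply metric_equiv_speed_le.
      + rewrite (RInt_const (V := R_CompleteNormedModule)). right.
        rewrite Rabs_left1 by lra. change (scal (b - a) c2) with ((b - a) * c2). ring. }
  destruct (Rle_dec x y) as [le|nle]; auto.
  rewrite arc_length_sym, Rabs_minus_sym. apply ordered; lra.
Qed.

(** The same [c2] bounds both chords and arc lengths, so the final constant does not depend on the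
    number of jumps. *)
Lemma arc_dist_upper (nd : nat) (x y : R) :
  Rabs (x - y) <= 2 * PI -> arc_dist nd gam x y <= c2 * Rabs (x - y).
Proof.
  intros h. unfold arc_dist.
  destruct (Nat.eqb nd 1); [apply arc_length_upper|now apply metric_equiv_upper].
Qed.

End ArcDistance.

(** * Limits of distances and lateral limits *)

(** A distance is jointly continuous by symmetry and the triangle inequality alone. Stating this for
    a general [d] covers both the modulus of a difference of values and [arc_dist], which is a
    function of parameters. *)
Lemma filterlim_pseudometric {S T U : Type} (d : U -> U -> R) (F : (S -> Prop) -> Prop)
    (G : (T -> Prop) -> Prop) (f : S -> U) (g : T -> U) (l m : U) :
  Filter F -> Filter G ->
  (forall x y, d x y = d y x) -> (forall x y z, d x z <= d x y + d y z) ->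
  (forall eps, 0 < eps -> F (fun x => d (f x) l < eps)) ->
  (forall eps, 0 < eps -> G (fun x => d (g x) m < eps)) ->
  filterlim (fun z => d (f (fst z)) (g (snd z))) (filter_prod F G) (locally (d l m)).
Proof.
  intros FF FG sym tri hf hg. apply filterlim_locally. intros [eps he].
  apply Filter_prod with (Q := fun x => d (f x) l < eps / 2)
    (R := fun y => d (g y) m < eps / 2).
  - apply hf; lra.
  - apply hg; lra.
  - intros x y hx hy. simpl. change (Rabs (d (f x) (g y) - d l m) < eps).
    pose proof (tri (f x) l (g y)). pose proof (tri l m (g y)).
    pose proof (tri l (f x) m). pose proof (tri (f x) (g y) m).
    rewrite (sym m (g y)) in *. rewrite (sym l (f x)) in *.
    apply Rabs_def1; lra.
Qed.

Lemma filterlim_Cmod_lt {T : Type} (F : (T -> Prop) -> Prop) (f : T -> C) (l : C) :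
  Filter F -> filterlim f F (locally l) ->
  forall eps, 0 < eps -> F (fun x => Cmod (f x - l) < eps).
Proof.
  intros FF h eps he.
  pose proof (proj1 (filterlim_locally_ball_norm (K := C_AbsRing) (U := C_NormedModule) f l) h
    (mkposreal eps he)) as H.
  exact H.
Qed.

(** [lim] is a total operator that is meaningful on Cauchy filters. An existing limit makes the
    image filter Cauchy, and completeness then gives convergence to [lim]. *)
Lemma filterlim_lim {T : Type} (F : (T -> Prop) -> Prop) (f : T -> C) :
  ProperFilter F -> (exists l : C, filterlim f F (locally l)) ->
  filterlim f F (locally (lim (T := C_CompleteNormedModule) (filtermap f F))).
Proof.
  intros PF [l hl]. apply filterlim_locally. intros eps.
  apply (complete_cauchy (T := C_CompleteNormedModule) (filtermap f F)).
  - now apply filtermap_proper_filter.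
  - intros e. exists l. apply hl. now exists e.
Qed.

(** * The Hölder bound on a completed arc *)

Section Seminorm.

Variable gam : R -> C.
Hypothesis Hgam : contour gam.
Variables c1 c2 : R.
Hypothesis Hc : metric_equiv gam c1 c2.
Variable nd : nat.
Variables (sigma a b : R) (v : C -> C).
Hypothesis Hab : a < b.
Hypothesis Hlen : b <= a + 2 * PI.
Hypothesis Hlen_lt : nd = 1%nat \/ b < a + 2 * PI.
Hypothesis Hholder : holder_on_arc nd gam sigma v a b.
Hypothesis Hleft : exists l : C, filterlim (fun u => v (gam u)) (at_left b) (locally l).
Hypothesis Hright : exists l : C, filterlim (fun u => v (gam u)) (at_right a) (locally l).

(** Endpoints and interior points are put in one form, a limit along a proper filter that lives on
    the open arc, so that one passage to the limit treats every pair of points. *)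
Lemma completed_approach (p : R) : a <= p <= b ->
  exists F : (R -> Prop) -> Prop, ProperFilter F /\ F (fun u => a < u < b) /\
    filter_le F (locally p) /\
    filterlim (fun u => v (gam u)) F (locally (completed gam v a b p)).
Proof.
  intros hp. unfold completed.
  assert (hba : 0 < b - a) by lra.
  destruct (Req_EM_T p a) as [->|na]; [|destruct (Req_EM_T p b) as [->|nb]].
  - exists (at_right a). split; [apply at_right_proper_filter|]. split; [|split].
    + exists (mkposreal _ hba). intros y hy hay.
      change (Rabs (y - a) < b - a) in hy. apply Rabs_def2 in hy; lra.
    + intros P [d hd]. exists d. intros; auto.
    + apply filterlim_lim; [apply at_right_proper_filter|exact Hright].
  - exists (at_left b). split; [apply at_left_proper_filter|]. split; [|split].
    + exists (mkposreal _ hba). intros y hy hyb.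
      change (Rabs (y - b) < b - a) in hy. apply Rabs_def2 in hy; lra.
    + intros P [d hd]. exists d. intros; auto.
    + apply filterlim_lim; [apply at_left_proper_filter|exact Hleft].
  (* At an interior point the principal filter at [p] serves, along which convergence is trivial. *)
  - exists (fun P => P p). split; [|split; [lra|split]].
    + split; [intros P hP; now exists p|]. split; auto.
    + intros P hP. now apply locally_singleton.
    + intros P hP. now apply locally_singleton in hP.
Qed.

Lemma arc_dist_small_near (p : R) (eps : R) : 0 < eps ->
  locally p (fun u => arc_dist nd gam u p < eps).
Proof.
  pose proof PI_RGT_0 as hpi. intros he. destruct Hc as (_ & hc2 & _).
  assert (hd : 0 < Rmin PI (eps / c2)).
  { apply Rmin_pos; auto. now apply Rdiv_lt_0_compat. }
  exists (mkposreal _ hd). intros y hy. change (Rabs (y - p) < Rmin PI (eps / c2)) in hy.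
  pose proof (Rmin_l PI (eps / c2)). pose proof (Rmin_r PI (eps / c2)).
  eapply Rle_lt_trans; [apply (arc_dist_upper gam Hgam c1 c2 Hc); lra|].
  apply Rlt_le_trans with (c2 * (eps / c2)).
  - apply Rmult_lt_compat_l; lra.
  - right; field; lra.
Qed.

Lemma completed_holder : exists K, forall p q, a <= p <= b -> a <= q <= b -> p <> q ->
  Cmod (completed gam v a b p - completed gam v a b q)
    <= K * Rpower (arc_dist nd gam p q) sigma.
Proof.
  destruct Hholder as [K hK]. exists K. intros p q hp hq npq.
  destruct (completed_approach p hp) as (F & PF & iF & lF & cF).
  destruct (completed_approach q hq) as (G & PG & iG & lG & cG).
  assert (hpq : 0 < arc_dist nd gam p q).
  { apply arc_dist_pos; auto. destruct Hlen_lt as [|lt]; auto. right.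
    unfold Rabs; destruct (Rcase_abs (p - q)); lra. }
  assert (L : filterlim
    (fun z => Cmod (v (gam (fst z)) - v (gam (snd z)))) (filter_prod F G)
    (locally (Cmod (completed gam v a b p - completed gam v a b q)))).
  { apply (filterlim_pseudometric (fun x y => Cmod (x - y)) F G
      (fun u => v (gam u)) (fun u => v (gam u))); try apply filter_filter.
    - apply Cmod_minus_sym.
    - intros; apply Cmod_minus_triangle.
    - now apply filterlim_Cmod_lt; [apply filter_filter|].
    - now apply filterlim_Cmod_lt; [apply filter_filter|]. }
  assert (D : filterlim (fun z => arc_dist nd gam (fst z) (snd z)) (filter_prod F G)
    (locally (arc_dist nd gam p q))).
  { apply (filterlim_pseudometric (arc_dist nd gam) F G (fun u => u) (fun u => u));
      try apply filter_filter.
    - intros; now apply arc_dist_sym.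
    - intros; now apply arc_dist_triangle.
    - intros eps he. now apply lF, arc_dist_small_near.
    - intros eps he. now apply lG, arc_dist_small_near. }
  (* [Rpower] is the continuous power function at positive arguments; this is where [hpq] enters. *)
  assert (hRp : continuous (fun d => K * Rpower d sigma) (arc_dist nd gam p q)).
  { apply (continuous_mult (K := R_AbsRing)); [apply continuous_const|].
    apply continuity_pt_filterlim, derivable_continuous_pt.
    eexists. now apply derivable_pt_lim_power. }
  assert (PFG : ProperFilter' (filter_prod F G)).
  { apply Proper_StrongProper, filter_prod_proper; auto. }
  apply (filterlim_le (F := filter_prod F G) (FF := PFG)
    (fun z => Cmod (v (gam (fst z)) - v (gam (snd z))))
    (fun z => K * Rpower (arc_dist nd gam (fst z) (snd z)) sigma)
    (Finite (Cmod (completed gam v a b p - completed gam v a b q)))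
    (Finite (K * Rpower (arc_dist nd gam p q) sigma))).
  (* Neighborhoods of half the distance are disjoint, so the approximating points differ, as the
     Hölder bound demands. *)
  - assert (hm : 0 < Rabs (p - q) / 2).
    { assert (0 < Rabs (p - q)) by (apply Rabs_pos_lt; lra). lra. }
    apply Filter_prod
      with (Q := fun u => Rabs (u - p) < Rabs (p - q) / 2 /\ a < u < b)
           (R := fun u => Rabs (u - q) < Rabs (p - q) / 2 /\ a < u < b).
    + apply filter_and; auto. apply lF. now exists (mkposreal _ hm).
    + apply filter_and; auto. apply lG. now exists (mkposreal _ hm).
    + intros x y [hx1 hx2] [hy1 hy2]. apply hK; auto. simpl. intros <-.
      apply Rabs_def2 in hx1. apply Rabs_def2 in hy1.
      unfold Rabs in *. destruct (Rcase_abs (p - q)); lra.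
  - exact L.
  - exact (filterlim_comp _ _ _ _ _ _ _ _ D hRp).
Qed.

(** Finiteness of the supremum matters: [real] maps [p_infty] to [0]. *)
Lemma holder_seminorm_bound (p q : R) : a <= p <= b -> a <= q <= b -> p <> q ->
  Cmod (completed gam v a b p - completed gam v a b q)
    <= holder_seminorm nd gam sigma v a b * Rpower (arc_dist nd gam p q) sigma.
Proof.
  intros hp hq npq. destruct completed_holder as [K hK].
  unfold holder_seminorm.
  match goal with |- context [Lub_Rbar ?E] => set (S := E) end.
  destruct (Lub_Rbar_correct S) as [ub least].
  assert (pos : forall x y, 0 < Rpower (arc_dist nd gam x y) sigma)
    by (intros; apply exp_pos).
  assert (leK : Rbar_le (Lub_Rbar S) (Finite K)).
  { apply least. intros x (th & th' & h1 & h2 & ne & ->). simpl.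
    apply Rle_div_l; [apply pos|]. now apply hK. }
  assert (in_S : S (Cmod (completed gam v a b p - completed gam v a b q)
                    / Rpower (arc_dist nd gam p q) sigma)) by now exists p, q.
  apply ub in in_S.
  (* [leK] excludes [p_infty], and the member [in_S] of the set excludes [m_infty]. *)
  destruct (Lub_Rbar S) as [s| |]; simpl in *; try contradiction.
  now apply Rle_div_l in in_S; [|apply pos].
Qed.

Lemma completed_near (Hsigma : 0 < sigma < 1) (p q r : R) :
  a <= p <= b -> a <= q <= b -> p <> q -> Rabs (p - q) <= r ->
  Cmod (completed gam v a b p - completed gam v a b q)
    <= Rmax 1 c2 * holder_seminorm nd gam sigma v a b * Rpower r sigma.
Proof.
  intros hp hq npq hr.
  pose proof (holder_seminorm_bound p q hp hq npq) as hb.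
  assert (hpq : 0 < arc_dist nd gam p q).
  { apply arc_dist_pos; auto. destruct Hlen_lt as [|lt]; auto. right.
    unfold Rabs; destruct (Rcase_abs (p - q)); lra. }
  assert (le : arc_dist nd gam p q <= c2 * r).
  { eapply Rle_trans; [apply (arc_dist_upper gam Hgam c1 c2 Hc)|].
    - unfold Rabs; destruct (Rcase_abs (p - q)); lra.
    - apply Rmult_le_compat_l; auto. destruct Hc as (_ & ? & _); lra. }
  assert (hr0 : 0 < r) by (assert (0 < Rabs (p - q)) by (apply Rabs_pos_lt; lra); lra).
  assert (hc2 : 0 < c2) by (destruct Hc as (_ & ? & _); auto).
  (* The sign follows from [hb] itself: a nonnegative modulus is at most the seminorm times a
     positive power. *)
  assert (hs : 0 <= holder_seminorm nd gam sigma v a b).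
  { pose proof (Cmod_ge_0 (completed gam v a b p - completed gam v a b q)).
    assert (0 < Rpower (arc_dist nd gam p q) sigma) by apply exp_pos. nra. }
  assert (pw : Rpower (arc_dist nd gam p q) sigma <= Rmax 1 c2 * Rpower r sigma).
  { eapply Rle_trans; [apply Rle_Rpower_l with (b := c2 * r); lra|].
    rewrite <- Rpower_mult_distr by auto.
    apply Rmult_le_compat_r; [left; apply exp_pos|].
    assert (1 <= Rmax 1 c2) by apply Rmax_l. assert (c2 <= Rmax 1 c2) by apply Rmax_r.
    (* Since the base [Rmax 1 c2] is at least 1, its exponent may be raised from [sigma] to 1, which
       frees the constant from [sigma]. *)
    rewrite <- (Rpower_1 (Rmax 1 c2)) by lra.
    apply Rle_trans with (Rpower (Rmax 1 c2) sigma).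
    - apply Rle_Rpower_l; lra.
    - apply Rle_Rpower; lra. }
  eapply Rle_trans; [exact hb|].
  replace (Rmax 1 c2 * holder_seminorm nd gam sigma v a b * Rpower r sigma)
    with (holder_seminorm nd gam sigma v a b * (Rmax 1 c2 * Rpower r sigma)) by ring.
  now apply Rmult_le_compat_l.
Qed.

End Seminorm.

(** * Kernel weights and the error of a weighted average *)

Lemma kernel_nonneg (W : R -> R) (r d : R) : weight_function W -> 0 <= kernel W r d.
Proof.
  intros hW. unfold kernel.
  destruct (Rlt_dec 0 d), (Rle_dec d r); try apply Rle_refl.
  apply (weight_nonneg W hW). split.
  - apply Rle_mult_inv_pos; lra.
  - apply Rle_div_l; lra.
Qed.

Lemma kernel_support (W : R -> R) (r d : R) : kernel W r d <> 0 -> 0 < d <= r.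
Proof.
  unfold kernel. destruct (Rlt_dec 0 d), (Rle_dec d r); intros h; now try (exfalso; lra).
Qed.

(** The total weight is kept as a factor instead of being set to 1, because partial sums of the
    weights are not normalized and the induction runs over them. *)
Lemma Cmod_weighted_sum_sub (w : nat -> R) (y : nat -> C) (L : C) (B : R) (N : nat) :
  (forall l, (1 <= l <= N)%nat -> 0 <= w l) ->
  (forall l, (1 <= l <= N)%nat -> w l <> 0 -> Cmod (y l - L) <= B) ->
  Cmod (sum_n_m (G := C_AbelianGroup) (fun l => (RtoC (w l) * y l)%C) 1 N
        - RtoC (sum_n_m w 1 N) * L) <= sum_n_m w 1 N * B.
Proof.
  intros hw hy. induction N as [|N IH].
  - rewrite !sum_n_m_zero by lia. change (zero (G := C_AbelianGroup)) with (RtoC 0).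
    change (zero (G := R_AbelianMonoid)) with 0.
    replace (RtoC 0 - RtoC 0 * L)%C with (RtoC 0) by ring. rewrite Cmod_0. lra.
  - rewrite !sum_n_Sm by lia.
    set (S := sum_n_m (G := C_AbelianGroup) _ 1 N) in *.
    set (s := sum_n_m w 1 N) in *.
    change (plus S (w (Datatypes.S N) * y (Datatypes.S N))%C)
      with (S + w (Datatypes.S N) * y (Datatypes.S N))%C.
    change (plus s (w (Datatypes.S N))) with (s + w (Datatypes.S N)).
    rewrite RtoC_plus.
    replace (S + w (Datatypes.S N) * y (Datatypes.S N)
             - (RtoC s + RtoC (w (Datatypes.S N))) * L)%C
      with ((S - RtoC s * L) + RtoC (w (Datatypes.S N)) * (y (Datatypes.S N) - L))%C by ring.
    eapply Rle_trans; [apply Cmod_triangle|]. rewrite Rmult_plus_distr_r.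
    apply Rplus_le_compat.
    + apply IH; intros; [apply hw|apply hy]; auto; lia.
    + rewrite Cmod_mult, Cmod_R, Rabs_right by (apply Rle_ge, hw; lia).
      destruct (Req_dec (w (Datatypes.S N)) 0) as [->|nz]; [lra|].
      apply Rmult_le_compat_l; [apply hw|apply hy]; auto; lia.
Qed.

(** The weights are nonnegative, sum to 1 and vanish outside the window, so a bound on the samples
    in the window passes to their average. *)
Lemma estimator_error (W : R -> R) (N : nat) (r : R) (d : nat -> R) (y : nat -> C)
    (L : C) (B : R) :
  weight_function W -> norm_sum W N r d <> 0 ->
  (forall l, (1 <= l <= N)%nat -> 0 < d l <= r -> Cmod (y l - L) <= B) ->
  Cmod (estimator W N r d y - L) <= B.
Proof.
  intros hW nz hy.
  assert (npos : 0 <= norm_sum W N r d).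
  { unfold norm_sum. eapply Rle_trans.
    { right. symmetry. apply (sum_n_m_const_zero (G := R_AbelianMonoid) 1 N). }
    apply sum_n_m_le. intros; now apply kernel_nonneg. }
  assert (one : sum_n_m (weight W N r d) 1 N = 1).
  { transitivity (/ norm_sum W N r d * norm_sum W N r d); [|now apply Rinv_l].
    eapply eq_trans; [|exact (sum_n_m_mult_l (K := R_Ring) (/ norm_sum W N r d)
      (fun q => kernel W r (d q)) 1 N)].
    apply sum_n_m_ext. intros l. apply Rmult_comm. }
  pose proof (Cmod_weighted_sum_sub (weight W N r d) y L B N) as E.
  rewrite one, Cmult_1_l, Rmult_1_l in E. apply E.
  - intros l _. apply Rle_mult_inv_pos; [now apply kernel_nonneg|lra].
  - intros l hl wnz. apply hy; auto. apply (kernel_support W).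
    intros z. apply wnz. unfold weight. rewrite z. unfold Rdiv; ring.
Qed.

(** * Cyclic differences *)

Lemma cdiff_mod (x y : R) : exists k : Z, cdiff x y = x - y + 2 * PI * IZR k.
Proof.
  exists (- Int_part ((x - y) / (2 * PI)))%Z. unfold cdiff. rewrite opp_IZR. ring.
Qed.

Lemma cdiff_range (x y : R) : 0 <= cdiff x y < 2 * PI.
Proof.
  pose proof PI_RGT_0. unfold cdiff.
  destruct (base_Int_part ((x - y) / (2 * PI))) as [h1 h2].
  set (m := IZR (Int_part ((x - y) / (2 * PI)))) in *.
  assert (e : x - y = 2 * PI * ((x - y) / (2 * PI))) by (field; lra).
  nra.
Qed.

Lemma cdiff_eq_0 (x y : R) (k : Z) : x - y = 2 * PI * IZR k -> cdiff x y = 0.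
Proof.
  intros e. destruct (cdiff_mod x y) as [m em]. pose proof (cdiff_range x y) as h.
  rewrite em, e, <- Rmult_plus_distr_l, <- plus_IZR in *.
  rewrite (small_two_PI_multiple (k + m)); [ring|].
  rewrite Rabs_right; lra.
Qed.

(** * The two continuity arcs at a jump and the errors of single samples *)

Section Arcs.

Variables (nd : nat) (thd : nat -> R).
Hypothesis Hthd : jump_params nd thd.

Lemma thd_le (i j : nat) : (1 <= i <= j)%nat -> (j <= nd)%nat -> thd i <= thd j.
Proof.
  intros [h1 hij] hj. induction hij as [|j hij IH]; [lra|].
  apply Rle_trans with (thd j); [apply IH; lia|]. left. apply Hthd. lia.
Qed.

(** An arc spans a full turn only when there is one jump; with more, [thd 1 < thd 2 <= thd nd] makes
    the arc through the cut strictly shorter. This alternative is what keeps the ends of a completed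
    arc at positive distance. *)
Lemma thd_next_gap (j : nat) : (1 <= j <= nd)%nat ->
  thd j < thd_next nd thd j <= thd j + 2 * PI /\
  (nd = 1%nat \/ thd_next nd thd j < thd j + 2 * PI).
Proof.
  intros hj. pose proof (proj1 Hthd j hj) as hj0. unfold thd_next.
  destruct (Nat.eqb_spec j nd) as [->|ne].
  - pose proof (proj1 Hthd 1%nat ltac:(lia)) as h1.
    pose proof (thd_le 1 nd ltac:(lia) ltac:(lia)).
    split; [lra|]. destruct (Nat.eq_dec nd 1) as [|n1]; auto. right.
    pose proof (proj2 Hthd 1%nat ltac:(lia)). pose proof (thd_le 2 nd ltac:(lia) ltac:(lia)).
    lra.
  - pose proof (proj2 Hthd j ltac:(lia)). pose proof (proj1 Hthd (S j) ltac:(lia)).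
    split; [lra|right; lra].
Qed.

(** The incoming arc of [t_j] is the outgoing arc of its predecessor [t_i], up to
    a full turn. *)
Lemma thd_prev_next (j : nat) : (1 <= j <= nd)%nat ->
  exists i, (1 <= i <= nd)%nat /\
    ((thd_prev nd thd j = thd i /\ thd j = thd_next nd thd i) \/
     (thd_prev nd thd j = thd i - 2 * PI /\ thd j = thd_next nd thd i - 2 * PI)).
Proof.
  intros hj. unfold thd_prev, thd_next.
  destruct (Nat.eqb_spec j 1) as [->|n1].
  - exists nd. split; [lia|]. right. rewrite Nat.eqb_refl. split; ring.
  - exists (Nat.pred j). split; [lia|]. left.
    destruct (Nat.eqb_spec (Nat.pred j) nd); [lia|]. split; auto. f_equal; lia.
Qed.

Variable gam : R -> C.
Hypothesis Hgam : contour gam.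
Variables (alpha : R) (f : C -> C).
Hypothesis Hf : PH nd gam thd alpha f.

Lemma holder_on_arc_periodic (a b : R) : holder_on_arc nd gam alpha f a b ->
  holder_on_arc nd gam alpha f (a - 2 * PI) (b - 2 * PI).
Proof.
  intros [K hK]. exists K. intros x y hx hy ne.
  rewrite <- (contour_periodic _ Hgam x), <- (contour_periodic _ Hgam y).
  rewrite <- arc_dist_periodic by auto. apply hK; lra.
Qed.

Lemma right_limit_periodic (a : R) :
  (exists l : C, filterlim (fun u => f (gam u)) (at_right a) (locally l)) ->
  exists l : C, filterlim (fun u => f (gam u)) (at_right (a - 2 * PI)) (locally l).
Proof.
  intros [l hl]. exists l. intros P hP. destruct (hl P hP) as [d hd]. exists d.
  intros y hy hay. rewrite <- (contour_periodic _ Hgam y). apply hd; [|lra].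
  change (Rabs (y - (a - 2 * PI)) < d) in hy. change (Rabs (y + 2 * PI - a) < d).
  now replace (y + 2 * PI - a) with (y - (a - 2 * PI)) by ring.
Qed.

(** For [j = nd] the arc ends at [thd 1 + 2 * PI], and periodicity carries the left limit at [thd 1]
    there. *)
Lemma PH_outgoing_arc (j : nat) : (1 <= j <= nd)%nat ->
  holder_on_arc nd gam alpha f (thd j) (thd_next nd thd j) /\
  (exists l : C, filterlim (fun u => f (gam u)) (at_left (thd_next nd thd j)) (locally l)) /\
  (exists l : C, filterlim (fun u => f (gam u)) (at_right (thd j)) (locally l)).
Proof.
  intros hj. destruct (Hf j hj) as (h1 & _ & h3). split; [|split]; auto.
  unfold thd_next. destruct (Nat.eqb_spec j nd) as [->|ne].
  - destruct (Hf 1%nat ltac:(lia)) as (_ & [l hl] & _).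
    exists l. intros P hP. destruct (hl P hP) as [d hd]. exists d.
    intros y hy hay.
    replace y with ((y - 2 * PI) + 2 * PI) by ring. rewrite (contour_periodic _ Hgam).
    apply hd; [|lra].
    change (Rabs (y - (thd 1%nat + 2 * PI)) < d) in hy.
    change (Rabs (y - 2 * PI - thd 1%nat) < d).
    now replace (y - 2 * PI - thd 1%nat) with (y - (thd 1%nat + 2 * PI)) by ring.
  - apply (Hf (S j)). lia.
Qed.

Lemma PH_incoming_arc (j : nat) : (1 <= j <= nd)%nat ->
  (thd_prev nd thd j < thd j <= thd_prev nd thd j + 2 * PI) /\
  (nd = 1%nat \/ thd j < thd_prev nd thd j + 2 * PI) /\
  holder_on_arc nd gam alpha f (thd_prev nd thd j) (thd j) /\
  (exists l : C, filterlim (fun u => f (gam u)) (at_left (thd j)) (locally l)) /\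
  (exists l : C, filterlim (fun u => f (gam u)) (at_right (thd_prev nd thd j)) (locally l)).
Proof.
  intros hj. destruct (thd_prev_next j hj) as (i & hi & hcase).
  destruct (thd_next_gap i hi) as [g1 g2].
  destruct (Hf i hi) as (h1 & _ & h3). destruct (Hf j hj) as (_ & h2 & _).
  destruct hcase as [[-> e]|[-> e]].
  - rewrite <- e in *. auto.
  - assert (hh : holder_on_arc nd gam alpha f (thd i - 2 * PI) (thd j)).
    { rewrite e. now apply holder_on_arc_periodic. }
    split; [lra|]. split; [destruct g2; [auto|right; lra]|].
    split; [auto|]. split; [auto|]. now apply right_limit_periodic.
Qed.

Variables c1 c2 : R.
Hypothesis Hc : metric_equiv gam c1 c2.
Hypothesis Halpha : 0 < alpha < 1.

(** The point [p] is the representative of [x] that lies on the incoming arc as parametrized; the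
    Hölder bound compares it with the endpoint [b], where the completed value is the lateral
    limit. *)
Lemma sample_error_minus (j : nat) (x r : R) : (1 <= j <= nd)%nat ->
  (forall i, (1 <= i <= nd)%nat -> cdiff x (thd i) <> 0) ->
  thd_prev nd thd j <= thd j - r -> 0 < cdiff (thd j) x <= r ->
  Cmod (f (gam x) - lat_minus gam f (thd j))
    <= Rmax 1 c2 * holder_seminorm nd gam alpha f (thd_prev nd thd j) (thd j)
       * Rpower r alpha.
Proof.
  intros hj hx hr hd.
  destruct (PH_incoming_arc j hj) as (g1 & g2 & h1 & h2 & h3).
  destruct (cdiff_mod (thd j) x) as [k ek].
  set (a := thd_prev nd thd j) in *. set (b := thd j) in *.
  set (p := b - cdiff b x).
  assert (ep : p = x + 2 * PI * IZR (- k)) by (unfold p; rewrite ek, opp_IZR; ring).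
  (* A window may fill its whole arc and so reach [a], where the completed value is a lateral limit
     and not [f]. No sample sits there, since [a] is a jump parameter up to a full turn. *)
  assert (pa : p <> a).
  { intros e. destruct (thd_prev_next j hj) as (i & hi & hcase). apply (hx i hi).
    destruct hcase as [[e' _]|[e' _]]; fold a in e'.
    - apply cdiff_eq_0 with k. rewrite opp_IZR in ep. lra.
    - apply cdiff_eq_0 with (k - 1)%Z. rewrite minus_IZR. rewrite opp_IZR in ep. lra. }
  pose proof (completed_near gam Hgam c1 c2 Hc nd alpha a b f ltac:(lra) ltac:(lra) g2
    h1 h2 h3 Halpha p b r ltac:(unfold p in *; lra) ltac:(lra) ltac:(unfold p; lra)) as E.
  unfold completed in E.
  destruct (Req_EM_T p a); [contradiction|].
  destruct (Req_EM_T p b); [unfold p in *; lra|].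
  destruct (Req_EM_T b a); [lra|]. destruct (Req_EM_T b b); [|contradiction].
  rewrite <- (contour_periodic_Z gam Hgam (- k) x), <- ep. apply E.
  unfold p. replace (b - cdiff b x - b) with (- cdiff b x) by ring.
  rewrite Rabs_Ropp, Rabs_right; lra.
Qed.

Lemma sample_error_plus (j : nat) (x r : R) : (1 <= j <= nd)%nat ->
  (forall i, (1 <= i <= nd)%nat -> cdiff x (thd i) <> 0) ->
  thd j + r <= thd_next nd thd j -> 0 < cdiff x (thd j) <= r ->
  Cmod (f (gam x) - lat_plus gam f (thd j))
    <= Rmax 1 c2 * holder_seminorm nd gam alpha f (thd j) (thd_next nd thd j)
       * Rpower r alpha.
Proof.
  intros hj hx hr hd.
  destruct (thd_next_gap j hj) as (g1 & g2).
  destruct (PH_outgoing_arc j hj) as (h1 & h2 & h3).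
  destruct (cdiff_mod x (thd j)) as [k ek].
  set (p := thd j + cdiff x (thd j)).
  assert (ep : p = x + 2 * PI * IZR k) by (unfold p; rewrite ek; ring).
  (* The far end of the arc is again a jump parameter modulo a full turn, so [completed] takes the
     value of [f] at [p]. *)
  assert (pb : p <> thd_next nd thd j).
  { intros e. rewrite ep in e. unfold thd_next in e.
    destruct (Nat.eqb_spec j nd).
    - apply (hx 1%nat); [lia|]. apply cdiff_eq_0 with (1 - k)%Z. rewrite minus_IZR. lra.
    - apply (hx (S j)); [lia|]. apply cdiff_eq_0 with (- k)%Z. rewrite opp_IZR. lra. }
  set (a := thd j) in *. set (b := thd_next nd thd j) in *.
  pose proof (completed_near gam Hgam c1 c2 Hc nd alpha a b f ltac:(lra) ltac:(lra) g2
    h1 h2 h3 Halpha p a r ltac:(unfold p in *; lra) ltac:(lra) ltac:(unfold p; lra)) as E.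
  unfold completed in E.
  destruct (Req_EM_T p a); [unfold p in *; lra|].
  destruct (Req_EM_T p b); [contradiction|].
  destruct (Req_EM_T a a); [|contradiction].
  rewrite <- (contour_periodic_Z gam Hgam k x), <- ep. apply E.
  unfold p. replace (a + cdiff x a - a) with (cdiff x a) by ring.
  rewrite Rabs_right; lra.
Qed.

End Arcs.

(** The constant is a function of the metric equivalence constants alone; that
    every contour admits such constants is part of the claim. *)
Theorem proposition4p1 :
  exists Cst : R -> R -> R,
  forall gam : R -> C, contour gam ->
  (exists c1 c2 : R, metric_equiv gam c1 c2) /\
  forall c1 c2 : R, metric_equiv gam c1 c2 ->
  forall (nd : nat) (thd : nat -> R), (1 <= nd)%nat -> jump_params nd thd ->
  forall (N : nat) (vth : nat -> R),
    cyclically_ordered N vth ->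
    (forall l j, (1 <= l <= N)%nat -> (1 <= j <= nd)%nat -> cdiff (vth l) (thd j) <> 0) ->
  forall rm rp : nat -> R,
    (forall j, (1 <= j <= nd)%nat ->
       0 < rm j /\ thd_prev nd thd j <= thd j - rm j /\
       0 < rp j /\ thd j + rp j <= thd_next nd thd j) ->
  forall W : R -> R, weight_function W ->
  forall (alpha : R) (f : C -> C), 0 < alpha < 1 -> PH nd gam thd alpha f ->
  forall (eps : R) (e y : nat -> C),
    (forall l, (1 <= l <= N)%nat -> Cmod (e l) <= eps) ->
    (forall l, (1 <= l <= N)%nat -> y l = (f (gam (vth l)) + e l)%C) ->
  forall j, (1 <= j <= nd)%nat ->
    norm_sum W N (rm j) (dist_minus thd vth j) <> 0 ->
    norm_sum W N (rp j) (dist_plus thd vth j) <> 0 ->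
  let Cgam := Cst c1 c2 in
  let fhat_minus := estimator W N (rm j) (dist_minus thd vth j) y in
  let fhat_plus := estimator W N (rp j) (dist_plus thd vth j) y in
  let delta_hat := (fhat_plus - fhat_minus)%C in
  let semi_minus := holder_seminorm nd gam alpha f (thd_prev nd thd j) (thd j) in
  let semi_plus := holder_seminorm nd gam alpha f (thd j) (thd_next nd thd j) in
  Cmod (fhat_minus - lat_minus gam f (thd j))
    <= Cgam * semi_minus * Rpower (rm j) alpha + eps
  /\ Cmod (fhat_plus - lat_plus gam f (thd j))
    <= Cgam * semi_plus * Rpower (rp j) alpha + eps
  /\ Cmod (delta_hat - jump gam f (thd j))
    <= Cgam * (semi_minus * Rpower (rm j) alpha + semi_plus * Rpower (rp j) alpha)
       + 2 * eps.
Proof.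
  (* The factor [c2] comes from bounding arc distances by parameter distances; the maximum with 1
     dominates its power [alpha] for every exponent below 1. *)
  exists (fun _ c2 => Rmax 1 c2). intros gam Hgam. split; [now apply contour_metric_equiv|].
  intros c1 c2 Hc nd thd hnd Hthd N vth _ hvth rm rp hr W hW alpha f Halpha Hf
    eps e y he hy j hj nzm nzp Cgam fm fp delta sm sp.
  destruct (hr j hj) as (_ & hrm & _ & hrp).
  (* Noise is added to the error of each sample before averaging, so it costs [eps] once in each
     one-sided estimate. *)
  assert (noisy : forall l L B, (1 <= l <= N)%nat ->
    Cmod (f (gam (vth l)) - L) <= B -> Cmod (y l - L) <= B + eps).
  { intros l L B hl h. rewrite hy by auto.
    replace (f (gam (vth l)) + e l - L)%C with ((f (gam (vth l)) - L) + e l)%C by ring.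
    eapply Rle_trans; [apply Cmod_triangle|]. apply Rplus_le_compat; auto. }
  assert (bm : Cmod (fm - lat_minus gam f (thd j)) <= Cgam * sm * Rpower (rm j) alpha + eps).
  { apply estimator_error; auto. intros l hl hd. apply noisy; auto.
    eapply sample_error_minus; eauto. }
  assert (bp : Cmod (fp - lat_plus gam f (thd j)) <= Cgam * sp * Rpower (rp j) alpha + eps).
  { apply estimator_error; auto. intros l hl hd. apply noisy; auto.
    eapply sample_error_plus; eauto. }
  split; [exact bm|]. split; [exact bp|].
  unfold delta, jump.
  (* The jump error is the difference of the two one-sided errors, which accounts for [2 * eps]. *)
  replace (fp - fm - (lat_plus gam f (thd j) - lat_minus gam f (thd j)))%C
    with ((fp - lat_plus gam f (thd j)) + - (fm - lat_minus gam f (thd j)))%C by ring.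
  eapply Rle_trans; [apply Cmod_triangle|]. rewrite Cmod_opp. lra.
Qed.
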